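(* Let $m\ge n\ge 2$, let $K_1\subset\mathbb{R}^n$ and $K_2\subset\mathbb{R}^m$ be proper cones, and let $L(A) = XAY$ be a linear map on $M_{m,n}$, where $X \in M_m$ and $Y \in M_n$ are fixed. Then $L(S(K_1,K_2)) \subset S(K_1,K_2)$ if and only if either $X(K_2^\circ) \subseteq K_2^\circ$ and $Y$ is $K_1$-inverse nonnegative, or $-X(K_2^\circ) \subseteq K_2^\circ$ and $-Y$ is $K_1$-inverse nonnegative.
   Context: $M_{m,n}$ is the space of real $m\times n$ matrices and $M_n = M_{n,n}$. A convex cone $K\subseteq\mathbb{R}^n$ is a set with $K+K\subseteq K$ and $\alpha K\subseteq K$ for all $\alpha\ge 0$; it is proper if it is closed, pointed ($K\cap -K=\{0\}$) and has nonempty interior $K^\circ$. A matrix $A\in M_{m,n}$ is $(K_1,K_2)$-semipositive if there exists $x\in K_1^\circ$ with $Ax\in K_2^\circ$; the set of such matrices is $S(K_1,K_2)$. A square matrix $Y$ is $K$-inverse nonnegative if $Y$ is invertible and $Y^{-1}(K)\subseteq K$. *)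

(* Defs.v *)
From mathcomp Require Import all_boot all_order all_algebra.
From mathcomp Require Import all_classical all_reals topology normedtype.

Set Implicit Arguments.
Unset Strict Implicit.
Unset Printing Implicit Defensive.

Import Order.TTheory GRing.Theory Num.Theory.
Import numFieldNormedType.Exports.

Local Open Scope classical_set_scope.
Local Open Scope ring_scope.

Definition is_convex_cone (R : realType) (n : nat) (K : set 'cV[R]_n) : Prop :=
  [set x + y | x in K & y in K] `<=` K /\
  forall alpha : R, 0 <= alpha -> [set alpha *: x | x in K] `<=` K.

Definition is_pointed_cone (R : realType) (n : nat) (K : set 'cV[R]_n) : Prop :=
  K `&` [set - x | x in K] = [set 0].

Definition is_proper_cone (R : realType) (n : nat) (K : set 'cV[R]_n) : Prop :=
  [/\ is_convex_cone K, closed K, is_pointed_cone K & interior K !=set0].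

Definition semipositive (R : realType) (m n : nat)
    (K1 : set 'cV[R]_n) (K2 : set 'cV[R]_m) : set 'M[R]_(m, n) :=
  [set A | exists2 x, interior K1 x & interior K2 (A *m x)].

Definition inverse_nonnegative (R : realType) (n : nat)
    (K : set 'cV[R]_n) (Y : 'M[R]_n) : Prop :=
  Y \in unitmx /\ [set invmx Y *m x | x in K] `<=` K.

(* Main.v *)
Require Import Defs.
From mathcomp Require Import all_boot all_order all_algebra.
From mathcomp Require Import all_classical all_reals topology normedtype derive.
From mathcomp Require Import ring lra.

(** Write [int K] for the interior of [K].  If [X] maps [int K2] into itself and
    [Y] is inverse nonnegative, then a witness [x] of the semipositivity of [A]
    yields the witness [invmx Y *m x] for [X *m A *m Y]; replacing [(X, Y)] by
    [(- X, - Y)] does not change the map, which gives the other alternative.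

    For the converse it suffices to test the map on rank-one matrices
    [v *m phi] with [v] in [int K2] and [phi] positive somewhere on [int K1].
    Such a matrix is semipositive, so some [y] in [int K1] makes
    [(phi *m Y *m y) 0 0 *: (X *m v)] an element of [int K2]
    ([semipositive_preserver_rank1]).  This has two consequences.
    - The scalar is nonzero, because [0] is not interior to a pointed cone;
      hence [X *m v] lies in [int K2] or in [- int K2] for every [v] in
      [int K2].  These sets are disjoint, so along a segment of [int K2] the
      sign cannot change, and [X] or [- X] maps [int K2] into itself
      ([stable_or_antistable]).
    - If [X] does, the scalar is positive.  So if [phi] is positive somewhere on
      [int K1], then so is [phi *m Y]; contrapositively, [phi *m Y <= 0] on [K1]
      forces [phi <= 0] on [K1].  Applied to [phi] and [- phi] with
      [phi *m Y = 0], this makes [Y] invertible, as [K1] spans the space.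
      Applied to [phi = - psi *m invmx Y], it says that the transpose of
      [invmx Y] preserves the dual cone, and the bipolar theorem turns this into
      [invmx Y] preserving [K1] ([inverse_nonnegative_dual]).

    The bipolar theorem is [cone_separation]: for [z] outside a closed convex
    cone, the vector from [z] to its nearest point in the cone is a separating
    functional. *)

Set Implicit Arguments.
Unset Strict Implicit.
Unset Printing Implicit Defensive.

Import Order.TTheory GRing.Theory Num.Theory.
Import numFieldNormedType.Exports.
Local Open Scope classical_set_scope.
Local Open Scope ring_scope.

(** * Continuity of matrix operations *)

Lemma mx_continuous_at (T U : topologicalType) (m n : nat)
    (f : T -> 'M[U]_(m, n)) (x : T) :
  (forall i j, {for x, continuous (fun y => f y i j)}) ->
  {for x, continuous f}.
Proof.
move=> fc B [P nP sPB]; apply: (@filterS _ _ _ (fun y => forall i j, P i j (f y i j))).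
  by move=> y Py; apply: sPB.
apply: filter_forall => i; apply: filter_forall => j.
exact: (fc i j _ (nP i j)).
Qed.

Lemma trmx_continuous (T : topologicalType) (m n : nat) :
  continuous (@trmx T m n).
Proof.
move=> M B [P nP sPB]; exists (fun j i => P i j) => [j i|N PN].
  by have := nP i j; rewrite mxE.
by apply: sPB => i j; rewrite mxE; exact: PN.
Qed.

Lemma sum_continuous (R : realType) (T : topologicalType) (n : nat)
    (F : 'I_n -> T -> R) :
  (forall i, continuous (F i)) -> continuous (fun x => \sum_i F i x).
Proof.
move=> Fc.
by apply: (@continuous_big _ _ +%R 0 xpredT (@add_continuous R)) => i _; exact: Fc.
Qed.

Lemma mulmx_continuous (R : realType) (m n p : nat) (A : 'M[R]_(m, n)) :
  continuous (fun B : 'M[R]_(n, p) => A *m B).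
Proof.
move=> B; apply: mx_continuous_at => i j.
have -> : (fun C : 'M[R]_(n, p) => (A *m C) i j) = fun C => \sum_k A i k * C k j.
  by apply/funext => C; rewrite mxE.
apply: sum_continuous => k {}B.
by apply: continuousM; [exact: cst_continuous|exact: coord_continuous].
Qed.

Lemma line_continuous (R : realType) (n : nat) (x u : 'cV[R]_n) :
  continuous (fun t : R => x + t *: u).
Proof.
move=> t; apply: cvgD; first exact: cvg_cst.
by apply: cvgZr_tmp => //; exact: cvg_id.
Qed.

(** * Interiors of convex cones *)

Section Cone.
Context {R : realType} {n : nat} {K : set 'cV[R]_n}.

(** The map [f] will be the inverse of a translation, of a homothety or of a
    linear isomorphism that sends [K] into itself: such transformations preserve
    interior points. *)
Lemma interior_transfer (f : 'cV[R]_n -> 'cV[R]_n) (x : 'cV[R]_n) :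
  {for x, continuous f} -> interior K (f x) -> (f @^-1` K `<=` K) ->
  interior K x.
Proof.
by move=> fc Kfx sK; apply: (@filterS _ _ _ (f @^-1` K)) => //; exact: fc.
Qed.

Lemma interior_move (x u : 'cV[R]_n) :
  interior K x -> exists2 e : R, 0 < e & K (x + e *: u).
Proof.
move=> Kx.
have : nbhs (x + 0 *: u) K by rewrite scale0r addr0.
move=> /(@line_continuous _ _ x u 0) /nbhs_ballP [e /= e0 eK].
exists (e / 2); first by rewrite divr_gt0.
apply: eK; rewrite /ball /= sub0r normrN gtr0_norm ?divr_gt0 //.
by rewrite ltr_pdivrMr // ltr_pMr // ltr1n.
Qed.

Hypothesis cK : is_convex_cone K.

Lemma coneD x y : K x -> K y -> K (x + y).
Proof. by move=> Kx Ky; apply: cK.1; exists x => //; exists y. Qed.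

Lemma coneZ a x : 0 <= a -> K x -> K (a *: x).
Proof. by move=> a0 Kx; apply: (cK.2 a a0); exists x. Qed.

Lemma cone_interiorD x y : interior K x -> K y -> interior K (x + y).
Proof.
move=> Kx Ky; apply: (@interior_transfer (fun z => z - y)).
- by apply: continuousB; [exact: cvg_id|exact: cst_continuous].
- by rewrite addrK.
- by move=> z /= Kz; rewrite -(subrK y z); exact: coneD.
Qed.

Lemma cone_interiorZ a x : 0 < a -> interior K x -> interior K (a *: x).
Proof.
move=> a0 Kx; apply: (@interior_transfer (fun z => a^-1 *: z)).
- exact: scaler_continuous.
- by rewrite scalerA mulVf ?gt_eqF // scale1r.
- move=> z /= Kz; rewrite -(scale1r z) -(@mulfV _ a) ?gt_eqF // -scalerA.
  by apply: coneZ => //; exact: ltW.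
Qed.

Lemma interior_segment v w t : interior K v -> interior K w -> 0 <= t <= 1 ->
  interior K (v + t *: (w - v)).
Proof.
move=> Kv Kw /andP[t0 t1].
have -> : v + t *: (w - v) = (1 - t) *: v + t *: w.
  by rewrite scalerBr scalerBl scale1r addrCA addrC.
have [->|t1'] := eqVneq t 1; first by rewrite subrr scale0r add0r scale1r.
apply: cone_interiorD.
  by apply: cone_interiorZ Kv; rewrite subr_gt0 lt_neqAle t1'.
exact: coneZ t0 (interior_subset Kw).
Qed.

End Cone.

(** Around an interior origin the cone would contain a nonzero vector together
    with its opposite; the dimension must be positive for such a vector to
    exist. *)
Lemma proper_cone_not0 (R : realType) (n : nat) (K : set 'cV[R]_n) :
  (0 < n)%N -> is_proper_cone K -> ~ interior K 0.
Proof.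
case: n K => // n K _ [cK _ pK _] K0.
pose u : 'cV[R]_n.+1 := const_mx 1.
have u0 : u != 0.
  apply/eqP => /matrixP /(_ 0 0); rewrite !mxE => /eqP.
  by rewrite oner_eq0.
have [e e0] := interior_move u K0; have [d d0] := interior_move (- u) K0.
rewrite !add0r => Kd Ke.
have : (K `&` [set - x | x in K]) u.
  split.
    rewrite -(scale1r u) -(@mulVf _ e) ?gt_eqF // -scalerA.
    by apply: coneZ => //; rewrite invr_ge0 ltW.
  exists (- u); last by rewrite opprK.
  rewrite -(scale1r (- u)) -(@mulVf _ d) ?gt_eqF // -scalerA.
  by apply: coneZ => //; rewrite invr_ge0 ltW.
by rewrite pK => /eqP; rewrite (negbTE u0).
Qed.

(** * Separation of a point from a closed convex cone *)

Section Separation.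
Context {R : realType} {n : nat}.
Implicit Types (u v w z : 'cV[R]_n) (K : set 'cV[R]_n).

Definition dot u v : R := (u^T *m v) 0 0.

Lemma dotE u v : dot u v = \sum_i u i 0 * v i 0.
Proof. by rewrite /dot mxE; apply: eq_bigr => i _; rewrite mxE. Qed.

Lemma dotC u v : dot u v = dot v u.
Proof. by rewrite !dotE; apply: eq_bigr => i _; rewrite mulrC. Qed.

Lemma dotDr u v w : dot u (v + w) = dot u v + dot u w.
Proof. by rewrite /dot mulmxDr mxE. Qed.

Lemma dotZr a u v : dot u (a *: v) = a * dot u v.
Proof. by rewrite /dot -scalemxAr mxE. Qed.

Lemma dotDZ u v t : dot (u + t *: v) (u + t *: v) =
  dot u u + t * (dot u v *+ 2) + t ^+ 2 * dot v v.
Proof.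
rewrite dotDr dotZr ![dot (u + _) _]dotC !dotDr !dotZr (dotC v u); ring.
Qed.

Lemma sqr_le_dot u i : u i 0 ^+ 2 <= dot u u.
Proof.
rewrite dotE (bigD1 i) //= -expr2 lerDl sumr_ge0 // => j _.
by rewrite -expr2 sqr_ge0.
Qed.

Lemma dot_ge0 u : 0 <= dot u u.
Proof. by rewrite dotE sumr_ge0 // => j _; rewrite -expr2 sqr_ge0. Qed.

Lemma dot_gt0 u : u != 0 -> 0 < dot u u.
Proof.
move=> u0; rewrite lt_neqAle dot_ge0 andbT; apply: contra u0 => /eqP du.
apply/eqP/matrixP => i j; rewrite ord1 mxE; apply/eqP.
by rewrite -sqrf_eq0 eq_le sqr_ge0 du sqr_le_dot.
Qed.

Lemma dist_continuous z : continuous (fun v : 'rV[R]_n => dot (z - v^T) (z - v^T)).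
Proof.
have -> : (fun v : 'rV[R]_n => dot (z - v^T) (z - v^T)) =
          (fun v : 'rV[R]_n => \sum_i (z i 0 - v 0 i) * (z i 0 - v 0 i)).
  by apply/funext => w; rewrite dotE; apply: eq_bigr => i _; rewrite !mxE.
apply: sum_continuous => i v.
have zv : {for v, continuous (fun v : 'rV[R]_n => z i 0 - v 0 i)}.
  by apply: continuousB; [exact: cst_continuous|exact: coord_continuous].
exact: (continuousM zv zv).
Qed.

(** Only the points of [K] at least as near to [z] as some fixed [k0] matter, and
    they form a compact set.  Compactness is used on row vectors, hence the
    transpositions. *)
Lemma nearest_point K z : closed K -> K !=set0 ->
  exists2 p, K p & forall y, K y -> dot (z - p) (z - p) <= dot (z - y) (z - y).
Proof.
move=> clK [k0 Kk0]; set D := dot (z - k0) (z - k0).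
pose f (v : 'rV[R]_n) := dot (z - v^T) (z - v^T).
pose C : set 'rV[R]_n := (trmx @^-1` K) `&` (f @^-1` [set r | r <= D]).
have Ck0 : C k0^T by split; rewrite /= /f /= trmxK.
have clC : closed C.
  apply: closedI.
    by apply: preimage_closed clK => v _; exact: trmx_continuous.
  by apply: preimage_closed (@closed_le R D) => v _; exact: dist_continuous.
have cC : compact C.
  apply: subclosed_compact clC (rV_compact (fun i =>
    @segment_compact R (z i 0 - (1 + D)) (z i 0 + (1 + D)))) _.
  move=> v [_ /= fv] i; rewrite /= in_itv /=.
  have := le_trans (sqr_le_dot (z - v^T) i) fv; rewrite !mxE.
  (* [r ^+ 2 <= D] bounds [`|r|] by [1 + D], since [`|r| <= 1 + r ^+ 2]. *)
  set a := z i 0; set b := v 0 i => abD.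
  have := sqr_ge0 (a - b - 2^-1); have := sqr_ge0 (a - b + 2^-1).
  by move=> h1 h2; apply/andP; split; rewrite -/b; nra.
have [|c] := EVT_min_rV (ex_intro _ _ Ck0) cC (f := f).
  by apply: continuous_subspaceT; exact: dist_continuous.
rewrite inE => -[Kc fc] cmin; exists c^T => // y Ky.
have [yD|/ltW yD] := leP (dot (z - y) (z - y)) D; last exact: le_trans yD.
have := cmin y^T; rewrite /f trmxK; apply.
by rewrite inE; split; rewrite /= /f /= trmxK.
Qed.

(** First-order optimality: a polynomial [t * b + t ^+ 2 * c] that is nonnegative
    for [0 < t <= 1] has nonnegative slope at [0]. *)
Lemma slope_ge0 (b c : R) :
  (forall t, 0 < t -> t <= 1 -> 0 <= t * b + t ^+ 2 * c) -> 0 <= b.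
Proof.
move=> h; rewrite leNgt; apply/negP => b0.
have d0 : 0 < `|c| - b + 1 by have := normr_ge0 c; lra.
(* At this [t] the term [t * `|c|] is still smaller than [- b]. *)
pose t := - b / (`|c| - b + 1).
have t0 : 0 < t by rewrite divr_gt0 // oppr_gt0.
have t1 : t <= 1 by rewrite ler_pdivrMr // mul1r; have := normr_ge0 c; lra.
have := h t t0 t1; have -> : t * b + t ^+ 2 * c = t * (b + t * c) by ring.
rewrite pmulr_rge0 //; apply/negP; rewrite -ltNge.
have : t * c <= t * `|c| by rewrite ler_pM2l // ler_norm.
suff : t * `|c| < - b by lra.
rewrite /t mulrAC ltr_pdivrMr // ltr_pM2l ?oppr_gt0 //; lra.
Qed.

(** With [p] nearest to [z] in [K] and [q := z - p], optimality at [p] in the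
    directions [k] of [K] and in the direction [- p] gives [dot q k <= 0] and
    [dot q p >= 0], so that [dot q z >= dot q q > 0]: the functional
    [- q^T] separates. *)
Lemma cone_separation K z : is_convex_cone K -> closed K -> K !=set0 -> ~ K z ->
  exists phi : 'rV[R]_n,
    (forall k, K k -> 0 <= (phi *m k) 0 0) /\ (phi *m z) 0 0 < 0.
Proof.
move=> cK clK K0 nKz; have [p Kp pmin] := nearest_point z clK K0.
set q := z - p in pmin.
have q0 : q != 0 by apply/eqP => /subr0_eq zp; apply: nKz; rewrite zp.
(* No feasible direction [w] at [p] leads closer to [z]. *)
have step w : (forall t, 0 < t -> t <= 1 -> K (p + t *: w)) -> dot q w <= 0.
  move=> Kw; rewrite -oppr_ge0 -(@pmulrn_lge0 _ _ 2) //.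
  apply: (@slope_ge0 _ (dot w w)) => t t0 t1; have := pmin _ (Kw t t0 t1).
  have -> : z - (p + t *: w) = q + (- t) *: w by rewrite opprD addrA scaleNr.
  rewrite dotDZ; lra.
have qk k : K k -> dot q k <= 0.
  by move=> Kk; apply: step => t t0 _; apply: coneD => //; apply: coneZ => //; exact: ltW.
have qp : dot q (- p) <= 0.
  apply: step => t _ t1; rewrite scalerN -{1}(scale1r p) -scalerBl.
  by apply: coneZ => //; rewrite subr_ge0.
exists (- q^T); split => [k Kk|]; rewrite mulNmx mxE.
  by rewrite oppr_ge0 qk.
rewrite oppr_lt0 -/(dot q z) -(subrK p z) -/q dotDr.
by move: qp (dot_gt0 q0); rewrite -scaleN1r dotZr; lra.
Qed.

End Separation.

(** * The sign of the left factor *)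

(** A form of the connectedness of the unit interval: [P] is open, and closed in
    the interval because it coincides there with [Q]. *)
Lemma segment_clopen (R : realType) (P Q : set R) : open P -> closed Q -> P `<=` Q ->
  (forall t, 0 <= t <= 1 -> Q t -> P t) -> P 0 -> P 1.
Proof.
move=> oP cQ PQ QP P0.
have PE : `[0, 1]%classic `&` P = `[0, 1]%classic.
  apply: (@segment_connected R 0 1).
  - by exists 0; split => //; rewrite /= in_itv /= lexx ler01.
  - by exists P.
  - exists Q => //; apply/seteqP; split=> t [t01 Pt]; split=> //; first exact: PQ.
    by apply: QP => //; move: t01; rewrite /= in_itv.
have : (`[0, 1]%classic `&` P) 1 by rewrite PE /= in_itv /= ler01 lexx.
by case.
Qed.

(** If [X *m v] is in the interior of [K] for one interior [v], it is so for every
    interior [w]: along the segment from [v] to [w], the points mapped into [K]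
    and those mapped into its interior are the same, since a point mapped into
    the interior of [- K] cannot be mapped into [K]. *)
Lemma stable_or_antistable (R : realType) (m : nat) (K : set 'cV[R]_m)
    (X : 'M[R]_m) (hm : (0 < m)%N) (hK : is_proper_cone K) :
  (forall v, interior K v -> interior K (X *m v) \/ interior K (- (X *m v))) ->
  (forall v, interior K v -> interior K (X *m v)) \/
  (forall v, interior K v -> interior K (- (X *m v))).
Proof.
move=> XK; have [cK clK _ _] := hK.
have excl u : interior K u -> K (- u) -> False.
  move=> Ku KNu; have : interior K (u - u) by exact: cone_interiorD.
  by rewrite subrr; exact: proper_cone_not0.
have [allX|/existsNP[w /not_implyP[Kw nXw]]] :=
  pselect (forall v, interior K v -> interior K (X *m v)); first by left.
right=> v Kv; case: (XK v Kv) => [XvK|NXvK]; last exact: NXvK.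
exfalso; apply: nXw.
pose g (t : R) := X *m (v + t *: (w - v)).
have gc : continuous g.
  move=> t; have lc := @line_continuous _ _ v (w - v) t.
  exact: (continuous_comp lc (@mulmx_continuous _ _ _ _ X _)).
have g1 : g 1 = X *m w by rewrite /g scale1r addrC subrK.
rewrite -g1; apply: (@segment_clopen _ (g @^-1` interior K) (g @^-1` K)).
- by apply: open_comp; [move=> t _; exact: gc|exact: open_interior].
- by apply: preimage_closed clK => t _; exact: gc.
- by move=> t; exact: interior_subset.
- move=> t t01 Kgt; have [h|Ng] := XK _ (interior_segment cK Kv Kw t01).
    exact: h.
  by exfalso; apply: (excl _ Ng); rewrite opprK.
- by rewrite /= /g scale0r addr0.
Qed.

(** * A dual criterion for inverse nonnegativity *)

(** Each [x] in [K] is the limit, as [t] decreases to [0], of the interior points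
    [t *: u + x], where [u] is interior. *)
Lemma functional_le0_closure (R : realType) (n : nat) (K : set 'cV[R]_n)
    (phi : 'rV[R]_n) : is_proper_cone K ->
  (forall x, interior K x -> (phi *m x) 0 0 <= 0) ->
  forall x, K x -> (phi *m x) 0 0 <= 0.
Proof.
move=> [cK _ _ [u Ku]] phiK x Kx; rewrite -oppr_ge0.
apply: (@slope_ge0 _ _ (- (phi *m u) 0 0)) => t t0 t1.
have Kut : interior K (t *: u + x).
  by apply: cone_interiorD => //; exact: cone_interiorZ.
(* The quadratic polynomial is [- t] times the value of [phi] at [t *: u + x]. *)
have := phiK _ Kut; rewrite mulmxDr -scalemxAr.
rewrite [X in X <= _]mxE [X in X + _]mxE => h.
have -> : t * - (phi *m x) 0 0 + t ^+ 2 * - (phi *m u) 0 0 =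
  t * - (t * (phi *m u) 0 0 + (phi *m x) 0 0) by ring.
by rewrite mulr_ge0 ?oppr_ge0 // ltW.
Qed.

Lemma functional_eq0 (R : realType) (n : nat) (K : set 'cV[R]_n)
    (phi : 'rV[R]_n) : interior K !=set0 ->
  (forall x, K x -> (phi *m x) 0 0 = 0) -> phi = 0.
Proof.
move=> [u Ku] phiK; apply/rowP => i; rewrite mxE.
have [e e0 Ke] := interior_move (delta_mx i 0) Ku.
have := phiK _ Ke; rewrite mulmxDr -scalemxAr mxE [X in _ + X]mxE.
rewrite (phiK _ (interior_subset Ku)) add0r -colE mxE => /eqP.
by rewrite mulf_eq0 gt_eqF //= => /eqP.
Qed.

(** The hypothesis says that [phi] is in the polar cone of [K] as soon as
    [phi *m Y] is.  A functional [phi] with [phi *m Y = 0] is thus in the polar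
    cone together with [- phi], hence is [0], and [Y] is invertible.  If
    [invmx Y *m x] were outside [K] for some [x] in [K], a functional [psi]
    separating it from [K] would contradict the hypothesis for
    [phi = - psi *m invmx Y]. *)
Lemma inverse_nonnegative_dual (R : realType) (n : nat) (K : set 'cV[R]_n)
    (Y : 'M[R]_n) : is_proper_cone K ->
  (forall phi : 'rV[R]_n,
     (forall y, K y -> (phi *m Y *m y) 0 0 <= 0) ->
     forall x, K x -> (phi *m x) 0 0 <= 0) ->
  inverse_nonnegative K Y.
Proof.
move=> hK dualY; have [cK clK _ K0] := hK.
have uY : Y \in unitmx.
  rewrite -row_free_unit; apply: inj_row_free => phi phiY.
  apply: (functional_eq0 K0) => x Kx; apply/eqP; rewrite eq_le.
  rewrite dualY //=; last by move=> y _; rewrite phiY mul0mx mxE.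
  suff : (- phi *m x) 0 0 <= 0 by rewrite mulNmx mxE oppr_le0.
  by apply: dualY => // y _; rewrite mulNmx phiY oppr0 mul0mx mxE.
split=> // _ [x Kx <-]; apply: contrapT => nK.
have [|psi [psiK psiz]] := cone_separation cK clK _ nK.
  by exists x.
have : (- (psi *m invmx Y) *m x) 0 0 <= 0.
  apply: dualY => // y Ky.
  by rewrite mulNmx mulmxKV // mulNmx mxE oppr_le0; exact: psiK.
by rewrite mulNmx mxE -mulmxA oppr_le0 leNgt psiz.
Qed.

(** * Preservers of semipositivity *)

Lemma rank1_mulE (R : realType) (m n : nat) (v : 'cV[R]_m) (phi : 'rV[R]_n)
    (x : 'cV[R]_n) : v *m phi *m x = (phi *m x) 0 0 *: v.
Proof. by rewrite -mulmxA {1}[phi *m x]mx11_scalar mul_mx_scalar. Qed.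

Section Preserver.
Context {R : realType} {m n : nat}.
Context {K1 : set 'cV[R]_n} {K2 : set 'cV[R]_m}.
Hypotheses (hm : (0 < m)%N) (hK1 : is_proper_cone K1) (hK2 : is_proper_cone K2).
Implicit Types (X : 'M[R]_m) (Y : 'M[R]_n).

Let cK1 : is_convex_cone K1. Proof. by have [] := hK1. Qed.
Let cK2 : is_convex_cone K2. Proof. by have [] := hK2. Qed.

Definition semipositive_preserver X Y :=
  forall A : 'M[R]_(m, n), semipositive K1 K2 A -> semipositive K1 K2 (X *m A *m Y).

Lemma semipositive_preserverN X Y :
  semipositive_preserver X Y -> semipositive_preserver (- X) (- Y).
Proof. by move=> h A /h; rewrite !mulNmx mulmxN opprK. Qed.

Lemma semipositive_preserver_of_nonneg X Y :
  [set X *m v | v in interior K2] `<=` interior K2 ->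
  inverse_nonnegative K1 Y -> semipositive_preserver X Y.
Proof.
move=> XK [uY YK] A [x Kx KAx]; exists (invmx Y *m x); last first.
  by rewrite -!mulmxA (mulKVmx uY); apply: XK; exists (A *m x); [exact: KAx|].
apply: (@interior_transfer _ _ _ (mulmx Y)); first exact: mulmx_continuous.
- by rewrite mulKVmx.
- by move=> z /= KYz; apply: YK; exists (Y *m z) => //; rewrite mulKmx.
Qed.

(** The rank-one test matrices [v *m phi] act by [rank1_mulE] as scalar multiples
    of [v], so they reduce semipositivity of the image to the position of the
    single vector [X *m v] relative to [K2]. *)
Lemma semipositive_preserver_rank1 X Y v (phi : 'rV[R]_n) x :
  semipositive_preserver X Y ->
  interior K2 v -> interior K1 x -> 0 < (phi *m x) 0 0 ->
  exists2 y, interior K1 y & interior K2 ((phi *m Y *m y) 0 0 *: (X *m v)).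
Proof.
move=> XY Kv Kx phix; have [|y Ky] := XY (v *m phi).
  by exists x => //; rewrite rank1_mulE; exact: cone_interiorZ.
move=> KXy; exists y; [exact: Ky|move: KXy].
by rewrite mulmxA -[_ *m Y]mulmxA rank1_mulE.
Qed.

(** Some functional must be positive at an interior point [x] of [K1]; [x^T] is
    one. *)
Lemma semipositive_preserver_sign X Y : (0 < n)%N -> semipositive_preserver X Y ->
  forall v, interior K2 v -> interior K2 (X *m v) \/ interior K2 (- (X *m v)).
Proof.
move=> n0 XY v Kv; have [_ _ _ [x Kx]] := hK1.
have x0 : x != 0 by apply/eqP => x0; apply: (proper_cone_not0 n0 hK1); rewrite -x0.
have [y _] := semipositive_preserver_rank1 XY Kv Kx (dot_gt0 x0).
set c := (_ 0 0) => Kc.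
have [c0|c0|c0] := ltgtP c 0.
- right; have -> : - (X *m v) = (- c)^-1 *: (c *: (X *m v)).
    by rewrite scalerA invrN mulNr mulVf ?lt_eqF // scaleN1r.
  by apply: cone_interiorZ Kc; rewrite // invr_gt0 oppr_gt0.
- left; have -> : X *m v = c^-1 *: (c *: (X *m v)).
    by rewrite scalerA mulVf ?gt_eqF // scale1r.
  by apply: cone_interiorZ Kc; rewrite // invr_gt0.
- by case: (proper_cone_not0 hm hK2); move: Kc; rewrite c0 scale0r.
Qed.

(** If [phi *m Y] is nonpositive on [K1] while [phi] is positive at an interior
    point, the test matrix [v *m phi] produces an interior point of [K2] of the
    form [c *: (X *m v)] with [c <= 0]; adding the element [- c *: (X *m v)] of
    [K2] makes [0] interior. *)
Lemma inverse_nonnegative_of_preserver X Y : semipositive_preserver X Y ->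
  [set X *m v | v in interior K2] `<=` interior K2 -> inverse_nonnegative K1 Y.
Proof.
move=> XY XK; apply: (inverse_nonnegative_dual hK1) => phi phiY.
apply: (functional_le0_closure hK1) => x Kx; rewrite leNgt; apply/negP => phix.
have [_ _ _ [v Kv]] := hK2.
have [y Ky] := semipositive_preserver_rank1 XY Kv Kx phix.
set c := (_ 0 0) => Kc.
have c0 : c <= 0 by apply: phiY; exact: interior_subset.
apply: (proper_cone_not0 hm hK2).
rewrite -(subrr (c *: (X *m v))) -scaleNr; apply: cone_interiorD => //.
apply: coneZ; rewrite ?oppr_ge0 //.
by apply: interior_subset; apply: XK; exists v.
Qed.

End Preserver.

Unset Implicit Arguments.

Theorem theorem3p29 (R : realType) (m n : nat) (hn : (2 <= n)%N)
  (hmn : (n <= m)%N) (K1 : set 'cV[R]_n) (K2 : set 'cV[R]_m)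
  (hK1 : is_proper_cone K1) (hK2 : is_proper_cone K2)
  (X : 'M[R]_m) (Y : 'M[R]_n)
  (L : {linear 'M[R]_(m, n) -> 'M[R]_(m, n)})
  (hL : forall A : 'M[R]_(m, n), L A = X *m A *m Y) :
  [set L A | A in semipositive K1 K2] `<=` semipositive K1 K2 <->
  ([set X *m v | v in interior K2] `<=` interior K2 /\
   inverse_nonnegative K1 Y) \/
  ([set (- X) *m v | v in interior K2] `<=` interior K2 /\
   inverse_nonnegative K1 (- Y)).
Proof.
have n0 : (0 < n)%N by exact: leq_trans hn.
have m0 : (0 < m)%N by exact: leq_trans hmn.
have LE : [set L A | A in semipositive K1 K2] `<=` semipositive K1 K2 <->
    @semipositive_preserver _ _ _ K1 K2 X Y.
  split=> [h A sA|h _ [A sA <-]]; rewrite -?hL; last by rewrite hL; exact: h.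
  by apply: h; exists A.
rewrite LE; split=> [XY|[[XK YK]|[XK YK]]].
- have [XK|XK] := stable_or_antistable m0 hK2
    (semipositive_preserver_sign m0 hK1 hK2 n0 XY).
    left; have XK' : [set X *m v | v in interior K2] `<=` interior K2.
      by move=> _ [v Kv <-]; exact: XK.
    by split; [exact: XK'|exact: inverse_nonnegative_of_preserver XK'].
  right; have XK' : [set (- X) *m v | v in interior K2] `<=` interior K2.
    by move=> _ [v Kv <-]; rewrite mulNmx; exact: XK.
  have XYN := semipositive_preserverN XY.
  split; [exact: XK'|].
  exact: (inverse_nonnegative_of_preserver m0 hK1 hK2 XYN XK').
- exact: semipositive_preserver_of_nonneg.
- rewrite -(opprK X) -(opprK Y); apply: semipositive_preserverN.
  exact: semipositive_preserver_of_nonneg.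
Qed.
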